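(* The forms $$M = X_1^4X_2^2 +X_1^2X_2^4 + X_3^6 - 3X_1^2X_2^2X_3^2,$$ $$R = X_1^6 +X_2^6 + X_3^6 + 3X_1^2X_2^2X_3^2 - (X_1^4X_2^2 + X_1^2X_2^4+X_1^4X_3^2+X_1^2X_3^4+X_2^4X_3^2+ X_2^2X_3^4),$$ $$S = X_1^4X_2^2+X_2^4X_3^2+X_3^4X_1^2-3X_1^2X_2^2X_3^2$$ are all stubborn, i.e. for every integer $k\ge 0$ none of $M^{2k+1}$, $R^{2k+1}$, $S^{2k+1}$ is a sum of squares.
   Context: A real form is nonnegative if it takes only nonnegative values on $\mathbb{R}^n$. A form of degree $d$ is a sum of squares if it equals $H_1^2+\dots+H_r^2$ for some real forms $H_i$ of degree $d/2$. A nonnegative form $P$ is stubborn if $P^k$ is not a sum of squares for any odd $k\ge 1$. *)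

(* Defs.v *)
From HB Require Import structures.
From mathcomp Require Import all_boot all_order all_algebra.
From mathcomp Require Import reals.
From mathcomp Require Import mpoly.

Set Implicit Arguments.
Unset Strict Implicit.
Unset Printing Implicit Defensive.

Import Order.TTheory GRing.Theory Num.Theory.
Local Open Scope ring_scope.

(* A form of degree d in n variables is a polynomial p : {mpoly R[n]} with
   p \is d.-homog; the zero polynomial is homogeneous of every degree, so the
   degree is passed explicitly below. *)

Definition nonnegative (R : realType) (n : nat) (p : {mpoly R[n]}) : Prop :=
  forall v : 'I_n -> R, 0 <= p.@[v].

(* Requiring d = 2 e, rather than using d./2, makes the predicate false for
   odd d. The empty sequence only adds the zero form, which is also 0 ^+ 2. *)
Definition sum_of_squares (R : realType) (n d : nat) (p : {mpoly R[n]}) : Prop :=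
  exists (e : nat) (H : seq {mpoly R[n]}),
    [/\ d = (2 * e)%N,
        forall h, h \in H -> h \is e.-homog
      & p = \sum_(h <- H) h ^+ 2].

Definition stubborn (R : realType) (n d : nat) (p : {mpoly R[n]}) : Prop :=
  [/\ p \is d.-homog,
      nonnegative p
    & forall k : nat, odd k -> ~ sum_of_squares (k * d)%N (p ^+ k)].

Section TernarySextics.
Variable R : realType.

Let x1 : {mpoly R[3]} := 'X_(@Ordinal 3 0 isT).
Let x2 : {mpoly R[3]} := 'X_(@Ordinal 3 1 isT).
Let x3 : {mpoly R[3]} := 'X_(@Ordinal 3 2 isT).

Definition motzkin : {mpoly R[3]} :=
  x1 ^+ 4 * x2 ^+ 2 + x1 ^+ 2 * x2 ^+ 4 + x3 ^+ 6
  - 3%:R * x1 ^+ 2 * x2 ^+ 2 * x3 ^+ 2.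

Definition robinson : {mpoly R[3]} :=
  x1 ^+ 6 + x2 ^+ 6 + x3 ^+ 6 + 3%:R * x1 ^+ 2 * x2 ^+ 2 * x3 ^+ 2
  - (x1 ^+ 4 * x2 ^+ 2 + x1 ^+ 2 * x2 ^+ 4 + x1 ^+ 4 * x3 ^+ 2
     + x1 ^+ 2 * x3 ^+ 4 + x2 ^+ 4 * x3 ^+ 2 + x2 ^+ 2 * x3 ^+ 4).

Definition choi_lam : {mpoly R[3]} :=
  x1 ^+ 4 * x2 ^+ 2 + x2 ^+ 4 * x3 ^+ 2 + x3 ^+ 4 * x1 ^+ 2
  - 3%:R * x1 ^+ 2 * x2 ^+ 2 * x3 ^+ 2.

End TernarySextics.

(* Main.v *)
Require Import Defs.
From mathcomp Require Import all_boot all_order all_algebra.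
From mathcomp Require Import reals fraction.
From mathcomp Require Import mpoly ring lra.

(** Each of the three sextics is P(x) = f(x1^2, x2^2, x3^2) for a cubic form f
    that is nonnegative on the positive orthant and whose curve f = 0 is
    rational, with an isolated real node at (1 : 1 : 1). With u + v + w = 0,
    the curve is parametrized by
      Motzkin   (u^3, v^3, u v w),
      Robinson  (u^2 (w - v), v^2 (u - w), w^2 (v - u)),
      Choi-Lam  (u^2 w, v^2 u, w^2 v),
    and the node is reached at the two conjugate roots of u^2 + u v + v^2.

    The core is an extremality statement: if F is a form of degree 3k with
    |F| <= f^k on the part of the positive orthant where f > 0, then
    F = c f^k. Indeed the inequality forces F to vanish to high order wherever
    f touches zero on the boundary or at the node. Pulled back to the
    parameter line, F becomes a binary form of degree 9k which is divisible
    by (u^2 + u v + v^2)^(2k) and by (u v w)^(2k) (by (u v)^(3k) for Motzkin):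
    10k > 9k zeros with multiplicity, so F vanishes on the curve
    ([contact_order], [motzkin_contact] and its two analogues). Since the
    curve is parametrized through its node, f divides F
    ([dvd_of_parametrization]); the quotient satisfies the same hypothesis for
    k - 1 and one inducts ([dominated_extremal]).

    If P^k is a sum of squares, every summand satisfies H^2 <= P^k. Were some H
    nonzero, one of its components under the sign changes x_i -> - x_i would be
    a nonzero H' with the same bound and with H'^2 = F(x1^2, x2^2, x3^2), so
    that H'^2 = c P^k by extremality. On a suitable line P is g(x^2) with
    g(0) > 0 and g negative somewhere on the negative axis, and for odd k no
    nonzero multiple of such a power is a square ([odd_power_not_square]).
    Hence c = 0, a contradiction ([stubborn_at_squares]). *)

Set Implicit Arguments.
Unset Strict Implicit.
Unset Printing Implicit Defensive.

Import Order.TTheory GRing.Theory Num.Theory.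
Local Open Scope ring_scope.

(** * Univariate polynomials near 0 *)

Section NearZero.
Variable R : realFieldType.
Implicit Types (p u : {poly R}) (x : R).

Lemma poly_bounded p : exists2 K, 0 <= K & forall x, 0 <= x <= 1 -> `|p.[x]| <= K.
Proof.
elim/poly_ind: p => [|p c [K K0 Kp]]; first by exists 0 => // x _; rewrite horner0 normr0.
exists (K + `|c|) => [|x /[dup] x01 /Kp px]; first by rewrite addr_ge0.
case/andP: x01 => x0 x1; rewrite hornerMXaddC (le_trans (ler_normD _ _)) // lerD2r.
by rewrite normrM (ger0_norm x0) (le_trans _ px) // ler_piMr.
Qed.

Lemma poly_near0 p : exists2 K, 0 <= K &
  forall x, 0 <= x <= 1 -> `|p.[x] - p.[0]| <= K * x.
Proof.
elim/poly_ind: p => [|p c _]; first by exists 0 => // x _; rewrite !horner0 subrr normr0 mul0r.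
have [K K0 Kp] := poly_bounded p; exists K => // x /[dup] x01 /Kp px.
case/andP: x01 => x0 x1.
by rewrite !hornerMXaddC mulr0 add0r addrK normrM (ger0_norm x0) ler_wpM2r.
Qed.

Lemma poly_gt0_near0 p : 0 < p.[0] ->
  exists2 d, 0 < d <= 1 & forall x, 0 < x < d -> 0 < p.[x].
Proof.
move=> p0; have [K K0 Kp] := poly_near0 p.
have K1 : 0 < K + p.[0] by rewrite ltr_wpDl.
exists (p.[0] / (K + p.[0])).
  by rewrite divr_gt0 //= ler_pdivrMr // mul1r lerDr.
move=> x /andP[x0]; rewrite ltr_pdivlMr // => xd.
have x1 : x < 1.
  rewrite -(ltr_pM2r K1) mul1r; apply: lt_le_trans xd _.
  by rewrite lerDr.
have /Kp : 0 <= x <= 1 by rewrite !ltW.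
rewrite ler_norml => /andP[h _].
have : 0 < x * p.[0] by apply: mulr_gt0.
move: h xd; rewrite mulrDr; lra.
Qed.

(** One power of X is extracted at a time: the quotient q so far satisfies
    |q(x)| <= K x near 0, which forces q(0) = 0. *)
Lemma dvdXn_near0 p n (K d : R) : 0 < d ->
  (forall x, 0 < x < d -> `|p.[x]| <= K * x ^+ n) -> 'X^n %| p.
Proof.
move=> d0; elim: n K => [|n IH] K pK; first by rewrite expr0 dvd1p.
have [|q pq] := dvdpP _ _ (IH (`|K| * d) _).
  move=> x /[dup] x0d /andP[x0 xd]; apply: le_trans (pK _ x0d) _.
  rewrite exprS mulrA ler_wpM2r ?exprn_ge0 ?(ltW x0) //.
  apply: le_trans (ler_norm _) _.
  by rewrite normrM (gtr0_norm x0) ler_wpM2l // ltW.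
suff q0 : root q 0.
  move: q0; rewrite -dvdp_XsubCl subr0 pq => /dvdpP[s ->].
  by rewrite -mulrA -exprS dvdp_mull.
apply/negPn/negP => /negPf; rewrite /root => q0.
have [L L0 qL] := poly_near0 q.
have [|e /andP[e0 e1] Me] := @poly_gt0_near0 (`|q.[0]|%:P - (K + L)%:P * 'X).
  by rewrite !hornerE subr0 normr_gt0 q0.
have [x x0 xm] : exists2 x, 0 < x & x < Num.min d e.
  have m0 : 0 < Num.min d e by rewrite lt_min d0 e0.
  by exists (Num.min d e / 2); [rewrite divr_gt0 | lra].
have [xd xe] : x < d /\ x < e by move: xm; rewrite lt_min => /andP[].
have := Me x; rewrite x0 xe !hornerE => /(_ isT).
have := pK x; rewrite x0 xd pq !hornerE normrM => /(_ isT).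
rewrite (ger0_norm (exprn_ge0 n (ltW x0))) exprS mulrA ler_pM2r ?exprn_gt0 // => qK.
have := qL x; rewrite (ltW x0) (ltW (lt_le_trans xe e1)) => /(_ isT).
have := ler_distD q.[x] 0 q.[0]; rewrite !sub0r !normrN; lra.
Qed.
End NearZero.

(** * Substitution into multivariate polynomials *)

Section Evaluation.
Variables (n : nat) (R S : comNzRingType).
Implicit Types (F : {mpoly R[n]}) (T : 'I_n -> S).

Lemma eq_mmap (h1 h2 : R -> S) T1 T2 F :
  h1 =1 h2 -> T1 =1 T2 -> mmap h1 T1 F = mmap h2 T2 F.
Proof.
move=> eh eT; apply: eq_bigr => m _; rewrite eh; congr (_ * _).
by apply: eq_bigr => i _; rewrite eT.
Qed.

(** Naturality of substitution; it lets one polynomial identity be read in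
    every ring needed below: numbers, polynomials in one or two variables,
    the field of fractions. *)
Lemma rmorph_mmap (S' : comNzRingType) (r : {rmorphism S -> S'}) (h : R -> S) T F :
  r (mmap h T F) = mmap (r \o h) (r \o T) F.
Proof.
rewrite /mmap rmorph_sum; apply: eq_bigr => m _; rewrite rmorphM; congr (_ * _).
by rewrite rmorph_prod; apply: eq_bigr => i _; rewrite rmorphXn.
Qed.

Lemma mmap_scale (h : R -> S) (c : S) T F d : F \is d.-homog ->
  mmap h (fun i => c * T i) F = c ^+ d * mmap h T F.
Proof.
move/dhomogP => Fd; rewrite /mmap big_distrr /= big_seq [RHS]big_seq.
apply: eq_bigr => m /Fd /=; rewrite mdegE => <-; rewrite mulrCA; congr (_ * _).
rewrite -prodrXr -big_split; apply: eq_bigr => i _.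
by rewrite exprMn.
Qed.

(** Arguments congruent modulo c give congruent values, as in any ring
    where c generates an ideal. *)
Lemma mmap_shift (h : R -> S) (c : S) T Y F :
  exists g, mmap h (fun i => T i + c * Y i) F = mmap h T F + c * g.
Proof.
pose cong a b := exists g, a = b + c * g.
have congM a1 b1 a2 b2 : cong a1 b1 -> cong a2 b2 -> cong (a1 * a2) (b1 * b2).
  by move=> [g ->] [g' ->]; exists (b1 * g' + g * b2 + c * g * g'); ring.
have cong_id a : cong a a by exists 0; rewrite mulr0 addr0.
apply: (big_ind2 cong) => [//|a1 b1 a2 b2 [g ->] [g' ->]|m _].
  by exists (g + g'); ring.
apply: (congM); first exact: cong_id.
apply: (big_ind2 cong) => [//|*|i _]; first exact: (congM).
elim: (m i) => [|e IH]; first exact: cong_id.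
by rewrite !exprS; apply: (congM) => //; exists (Y i).
Qed.
End Evaluation.

Lemma size_mmap_homog (n : nat) (R : comNzRingType) (T : 'I_n -> {poly R}) F d s :
  F \is d.-homog -> (forall i, (size (T i) <= s.+1)%N) ->
  (size (mmap polyC T F) <= (s * d).+1)%N.
Proof.
move=> /dhomogP Fd Ts; rewrite /mmap big_seq.
apply: (big_ind (fun p : {poly R} => (size p <= (s * d).+1)%N)) => [|p q ps qs|m /Fd /=].
- by rewrite size_poly0.
- by rewrite (leq_trans (size_polyD _ _)) // geq_max ps.
have sizeM (p q : {poly R}) a b : (size p <= a.+1)%N -> (size q <= b.+1)%N ->
    (size (p * q)%R <= (a + b).+1)%N.
  move=> pa qb; apply: leq_trans (size_polyMleq _ _) _.
  by rewrite -subn1 leq_subLR (leq_trans (leq_add pa qb)) // addSn addnS.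
rewrite mdegE => <-; rewrite -[X in X.+1]add0n.
apply: (sizeM); first exact: size_polyC_leq1.
rewrite big_distrr /=.
apply: (big_ind2 (fun (p : {poly R}) e => (size p <= e.+1)%N)) => [|p a q b|i _].
- by rewrite size_poly1.
- exact: sizeM.
apply: leq_trans (size_poly_exp_leq _ _) _; rewrite ltnS leq_mul2r.
by case: (size (T i)) (Ts i) => [|t] /=; rewrite ?leq0n ?ltnS => ?; apply/orP; right.
Qed.

(** * Orders of vanishing forced by an inequality *)

Lemma poly_eq0_interval (R : realFieldType) (q : {poly R}) (x y : R) :
  x < y -> (forall z, x < z < y -> root q z) -> q = 0.
Proof.
move=> xy qxy; apply/eqP/negPn/negP => q0.
pose s := [seq x + (y - x) / i.+2%:R | i <- iota 0 (size q)].
have s_root : all (root q) s.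
  apply/allP => _ /mapP[i _ ->]; apply: qxy.
  have i0 : 0 < (i.+2%:R : R)^-1 by rewrite invr_gt0.
  have i1 : (i.+2%:R : R)^-1 < 1 by rewrite invf_lt1 // ltr1n.
  rewrite ltrDl mulr_gt0 ?subr_gt0 //= addrC -ltrBrDr.
  by rewrite gtr_pMr // subr_gt0.
have s_uniq : uniq s.
  rewrite map_inj_uniq ?iota_uniq // => i j /addrI /mulfI.
  rewrite subr_eq0 gt_eqF // => /(_ isT) /invr_inj /eqP.
  by rewrite eqr_nat => /eqP[].
by have := max_poly_roots q0 s_root s_uniq; rewrite size_map size_iota ltnn.
Qed.

Section Contact.
Variables (R : realFieldType) (n : nat).
Implicit Types (f F : {mpoly R[n]}) (T : 'I_n -> {poly {poly R}}).

(** Points where f vanishes are left out so that the property passes from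
    f * G at level k + 1 to G at level k by plain division. *)
Definition dominated f k F := forall v : 'I_n -> R,
  (forall i, 0 < v i) -> 0 < f.@[v] -> `|F.@[v]| <= f.@[v] ^+ k.

(** In {poly {poly R}} the outer variable will measure the distance to a curve
    and the inner one is the parameter z on the curve. *)
Lemma horner2_mmap T F (e z : R) :
  (map_poly (horner_eval z) (mmap (polyC \o polyC) T F)).[e]
    = F.@[fun i => (T i).[e%:P].[z]].
Proof.
rewrite -[e in LHS](hornerC e z) -[e%:P.[z]]/(horner_eval z e%:P) horner_map.
rewrite -[_.[e%:P]]/(horner_eval e%:P _) !rmorph_mmap.
by apply: eq_mmap => c //=; rewrite /horner_eval !hornerC.
Qed.

(** An order of vanishing on a curve that lies outside of the positive orthant,
    obtained from an inequality on the orthant. The family T(z, t) is inside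
    the orthant for z in one interval and t > 0, with f = t^w U there; so
    F(T(z, t)) = O(t^(wk)), and its first w k coefficients in t, which are
    polynomials in z, vanish on an interval, hence identically. The
    divisibility by t^(wk) is then an identity of polynomials, in which t can
    be replaced by any polynomial e(z), also where signs are wrong. *)
Lemma order_along_thickening f F k w T (U : {poly {poly R}}) (x y : R) (e : {poly R}) :
    x < y -> dominated f k F ->
    (forall z t, x < z < y -> 0 < t -> forall i, 0 < (T i).[t%:P].[z]) ->
    (forall z t, f.@[fun i => (T i).[t%:P].[z]] = t ^+ w * U.[t%:P].[z]) ->
    (forall z, x < z < y -> 0 < U.[0].[z]) ->
  e ^+ (w * k) %| mmap polyC (fun i => (T i).[e]) F.
Proof.
move=> xy domF T0 fT U0; set N := (w * k)%N.
pose p : {poly {poly R}} := mmap (polyC \o polyC) T F.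
have p_low j : (j < N)%N -> p`_j = 0.
  move=> jN; apply: (poly_eq0_interval xy) => z xzy.
  pose u := map_poly (horner_eval z) U.
  have uE t : u.[t] = U.[t%:P].[z].
    by rewrite -[t in LHS](hornerC t z) -[t%:P.[z]]/(horner_eval z t%:P) horner_map.
  have [|d /andP[d0 d1] ud] := @poly_gt0_near0 _ u; first by rewrite uE U0.
  have [K K0 uK] := poly_bounded u.
  have : 'X^N %| map_poly (horner_eval z) p.
    apply: (@dvdXn_near0 _ _ _ (K ^+ k) d d0) => t /[dup] /ud ut /andP[t0 td].
    rewrite horner2_mmap.
    have tu : f.@[fun i => (T i).[t%:P].[z]] = t ^+ w * u.[t] by rewrite fT uE.
    apply: le_trans (domF _ _ _) _; first by move=> i; apply: T0.
      by rewrite tu mulr_gt0 ?exprn_gt0.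
    rewrite tu exprMn mulrC -exprM ler_wpM2r ?exprn_ge0 ?(ltW t0) //.
    rewrite lerXn2r ?nnegrE ?(ltW ut) //; apply: le_trans (ler_norm _) (uK _ _).
    by rewrite !ltW // (lt_le_trans td).
  case/dvdpP => q /(congr1 (fun p : {poly R} => p`_j)).
  by rewrite coefMXn jN coef_map /= => /eqP; rewrite /horner_eval.
have pE : p = drop_poly N p * 'X^N.
  rewrite -[LHS](poly_take_drop N) [take_poly _ _](_ : _ = 0) ?add0r //.
  by apply/polyP => j; rewrite coef_take_poly coef0; case: ifP => // /p_low.
suff -> : mmap polyC (fun i => (T i).[e]) F = p.[e].
  by rewrite pE hornerM hornerXn dvdp_mull.
rewrite -[_.[e]]/(horner_eval e _) rmorph_mmap.
by apply: eq_mmap => c //=; rewrite /horner_eval hornerC.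
Qed.
End Contact.

(** * Extremality and division by the equation of a parametrized curve *)

(** Only the component of degree e of G contributes to f * G. *)
Lemma homog_cofactor (n : nat) (R : idomainType) (f G : {mpoly R[n]}) d e :
  f \is d.-homog -> f * G \is (d + e).-homog -> exists2 G', G' \is e.-homog & f * G = f * G'.
Proof.
move=> fd fGd; exists (pihomog mdeg e G); first exact: pihomogP.
rewrite -[LHS](pihomog_dE fGd).
rewrite [in LHS](pihomog_partitionE (leqnn (mmeasure mdeg G))) mulr_sumr raddf_sum /=.
have fGi i : f * pihomog mdeg i G \is (d + i).-homog by exact/dhomogM/pihomogP.
case: (ltnP e (mmeasure mdeg G)) => eG.
  rewrite (bigD1 (Ordinal eG)) //= pihomog_dE // big1 ?addr0 // => i ie.
  by rewrite (pihomog_ne0 _ (fGi i)) // eqn_add2l.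
rewrite big1 => [|i _]; last first.
  by rewrite (pihomog_ne0 _ (fGi i)) // eqn_add2l ltn_eqF // (leq_trans (ltn_ord i)).
rewrite [pihomog _ _ _](_ : _ = 0) ?mulr0 // pihomogE big_seq_cond big1 // => m.
case/andP=> /mmeasure_mnm_lt mG /eqP me; by move: eG; rewrite -me leqNgt mG.
Qed.

Section Extremal.
Variables (R : realFieldType) (n : nat) (f : {mpoly R[n]}) (phi : 'I_n -> {poly R}).
Variables (B : {poly R}) (d : nat).

(** If the pullback of F were nonzero, it would have degree at most d * (d k)
    and be divisible by B^k, of larger degree. So F vanishes on the curve,
    hence F = f G; and G is dominated at level k - 1. *)
Lemma dominated_extremal k (F : {mpoly R[n]}) :
    f != 0 -> f \is d.-homog -> (forall i, (size (phi i) <= d.+1)%N) ->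
    (d * d < (size B).-1)%N ->
    (forall G e, G \is e.-homog -> mmap polyC phi G = 0 -> exists G', G = f * G') ->
    (forall j G, G \is (d * j).-homog -> dominated f j G -> B ^+ j %| mmap polyC phi G) ->
  F \is (d * k).-homog -> dominated f k F -> exists c, F = c *: f ^+ k.
Proof.
move=> f0 fd phid dB curve contact; elim: k F => [|k IH] F Fd Fdom.
  exists F@_0%MM; rewrite expr0 {1}[F](_ : _ = (F@_0%MM)%:MP) ?alg_mpolyC //.
  apply/mpolyP => m; rewrite mcoeffC; have [<-|m0] := eqVneq 0%MM m; first by rewrite mulr1.
  rewrite mulr0; apply: (dhomog_nemf_coeff Fd) => /=.
  by rewrite muln0 mdeg_eq0 eq_sym.
have [G FG] : exists G, F = f * G.
  apply: (curve _ _ Fd); apply/eqP/negPn/negP => F0.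
  have /leq_trans/(_ (size_mmap_homog Fd phid)) := dvdp_leq F0 (contact _ _ Fd Fdom).
  move=> /(leq_sub2r 1); rewrite !subn1 size_exp /= mulnA leq_pmul2r //.
  by rewrite leqNgt dB.
rewrite FG mulnS in Fd; have [G' G'd FG'] := homog_cofactor fd Fd.
move: Fdom; rewrite {F}FG FG' => Fdom {Fd}.
have [|c ->] := IH G' G'd; last by exists c; rewrite exprS scalerAr.
move=> v v0 fv; have := Fdom v v0 fv.
by rewrite mevalM normrM (gtr0_norm fv) exprS ler_pM2l.
Qed.
End Extremal.

Section Division.
Variables (n : nat) (R : idomainType).
Implicit Types (f D F l : {mpoly R[n]}).

Lemma mmap_id F : mmap (@mpolyC n R) (fun i => 'X_i) F = F.
Proof.
rewrite -[RHS]comp_mpoly_id; apply: eq_mmap => // i.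
by rewrite tnth_mktuple.
Qed.

(** Divisibility by a linear form l is tested by restricting to the hyperplane
    l = 0, which is the substitution t. As D does not vanish identically
    there, l divides r, and then cancels. *)
Lemma cancel_linear l D (t y : 'I_n -> {mpoly R[n]}) r g :
    l != 0 -> (forall i, 'X_i = t i + l * y i) ->
    mmap (@mpolyC n R) t l = 0 -> mmap (@mpolyC n R) t D != 0 ->
  D * r = l * g -> exists s, g = D * s.
Proof.
move=> l0 tE tl tD Drlg.
have l_dvd p : mmap (@mpolyC n R) t p = 0 -> exists s, p = l * s.
  move=> tp; have [s] := mmap_shift (@mpolyC n R) l t y p.
  rewrite (eq_mmap (h2 := @mpolyC n R) (T2 := fun i => 'X_i)) // mmap_id tp add0r => ps.
  by exists s.
have [|s rs] := l_dvd r.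
  have := congr1 (mmap (@mpolyC n R) t) Drlg; rewrite !rmorphM /= tl mul0r.
  by move/eqP; rewrite mulf_eq0 (negPf tD) => /eqP.
by exists s; apply: (mulfI l0); rewrite -Drlg rs mulrCA.
Qed.

(** The hypothesis D X_i = f + Phi_i says that, modulo f, the point
    (X_1, ..., X_n) is proportional to Phi, with factor D: Phi inverts the
    projection of the curve f = 0 from its singular point. By homogeneity
    D^d F = F(Phi + f) = F(Phi) = 0 modulo f. The factors D are cancelled
    using f = D X_i0 - Phi_i0, where Phi_i0 is prime to D. *)
Lemma dvd_of_parametrization f D (Phi : 'I_n -> {mpoly R[n]}) i0 F d :
    D != 0 -> (forall i, D * 'X_i = f + Phi i) ->
    (forall r g, D * r = Phi i0 * g -> exists s, g = D * s) ->
    F \is d.-homog -> mmap (@mpolyC n R) Phi F = 0 ->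
  exists G, F = f * G.
Proof.
move=> D0 DX DPhi Fd F0.
have [g Fg] : exists g, D ^+ d * F = f * g.
  have [g gE] := mmap_shift (@mpolyC n R) f Phi (fun=> 1) F.
  exists g; rewrite F0 add0r in gE; rewrite -gE -{1}[F]mmap_id.
  rewrite -(mmap_scale _ _ _ Fd); apply: eq_mmap => // i.
  by rewrite DX mulr1 addrC.
elim: d g Fg {Fd} => [|d IH] g Fg; first by exists g; rewrite -Fg mul1r.
have [s gs] : exists s, g = D * s.
  apply: (DPhi ('X_i0 * g - D ^+ d * F)).
  by rewrite mulrBr mulrA DX mulrA -exprS Fg mulrDl addrAC subrr add0r.
apply: (IH s); apply: (mulfI D0).
by rewrite mulrA -exprS Fg gs mulrCA.
Qed.
End Division.

Section Homogenize.
Local Notation "x %:F" := (tofrac x).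
Variables (n s : nat) (R : idomainType).
Variable phi : forall A : comNzRingType, A -> A -> 'I_n -> A.
Hypothesis phi_morph : forall (A B : comNzRingType) (r : {rmorphism A -> B}) u v i,
  r (phi u v i) = phi (r u) (r v) i.
Hypothesis phi_homog : forall (A : comNzRingType) (c u v : A) i,
  phi (c * u) (c * v) i = c ^+ s * phi u v i.

(** Vanishing along the affine parameter (u : v) = (z : z + 1) implies vanishing
    for any pair u, v: take z = u / (v - u) in the field of fractions. This
    chart puts u = v at infinity, where none of the three cubics below has a
    contact point, so that all their zeros are counted at finite z. *)
Lemma mmap_homogenize (u v : {mpoly R[n]}) (F : {mpoly R[n]}) d :
    u != v -> F \is d.-homog -> mmap polyC (phi 'X ('X + 1)) F = 0 ->
  mmap (@mpolyC n R) (phi u v) F = 0.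
Proof.
move=> uv Fd F0.
pose K : fieldType := {fraction {mpoly R[n]}}.
have vu0 : (v - u)%:F != 0 :> K by rewrite tofrac_eq0 subr_eq0 eq_sym.
pose z : K := u%:F / (v - u)%:F.
pose io : {rmorphism R -> K} := @tofrac _ \o @mpolyC n R.
pose ev : {rmorphism {poly R} -> K} := horner_eval z \o map_poly io.
have uE : u%:F = (v - u)%:F * z by rewrite mulrC divfK.
have vE : v%:F = (v - u)%:F * (z + 1).
  by rewrite mulrDr -uE mulr1 -rmorphD /= addrC subrK.
apply/eqP; rewrite -tofrac_eq0 rmorph_mmap.
rewrite (eq_mmap (h2 := io) (T2 := fun i => (v - u)%:F ^+ s * phi z (z + 1) i)) //.
  rewrite (mmap_scale _ _ _ Fd) mulf_eq0; apply/orP; right.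
  have evX : ev 'X = z by rewrite /= map_polyX /horner_eval hornerX.
  have := congr1 ev F0; rewrite rmorph0 rmorph_mmap => <-; apply/eqP.
  apply: eq_mmap => [c|i].
    by rewrite /= map_polyC /horner_eval hornerC.
  by rewrite [RHS]phi_morph rmorphD rmorph1 evX.
move=> i; transitivity (phi u%:F v%:F i); first exact: phi_morph.
by rewrite uE [v%:F]vE phi_homog.
Qed.
End Homogenize.

(** * From sums of squares to the positive orthant *)

Section OddPower.
Variable R : realFieldType.

(** Since h^2 is even, h is odd or even. If it is odd then h(0) = 0 and c = 0.
    If h = e(x^2) then e^2 = c g^k; the value at 0 gives c >= 0, and the value
    at y, where g^k < 0 as k is odd, gives c <= 0. *)
Lemma odd_power_not_square (h g : {poly R}) c k y :
    odd k -> 0 < g.[0] -> y < 0 -> g.[y] < 0 ->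
  h ^+ 2 = c *: (g \Po 'X^2) ^+ k -> c = 0.
Proof.
move=> ok g0 y0 gy hsq.
have g2N : (g \Po 'X^2) \Po (- 'X) = g \Po 'X^2.
  by rewrite -comp_polyA comp_Xn_poly sqrrN.
have : (h \Po (- 'X)) ^+ 2 == h ^+ 2.
  by rewrite -rmorphXn /= hsq comp_polyZ rmorphXn /= g2N.
have h0 : h.[0] ^+ 2 = c * g.[0] ^+ k.
  by rewrite -horner_exp hsq hornerZ horner_exp horner_comp hornerXn expr0n.
rewrite eqf_sqr => /orP[] /eqP hN; last first.
  have : h.[0] = - h.[0] by rewrite -{1}oppr0 -hornerN -hN horner_comp !hornerE oppr0.
  move/eqP; rewrite -addr_eq0 -mulr2n mulrn_eq0 /= => /eqP hz.
  move/eqP: h0; rewrite hz expr0n eq_sym mulf_eq0 => /orP[/eqP //|].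
  by rewrite expf_eq0 gt_eqF // andbF.
pose e := even_poly h.
have he : h = e \Po 'X^2.
  have hE2 := poly_even_odd h; move: hN; rewrite -{1 2}hE2 rmorphD rmorphM /=.
  rewrite -!comp_polyA comp_Xn_poly sqrrN comp_polyX mulrN => /addrI.
  move/eqP; rewrite eq_sym -addr_eq0 -mulr2n -scaler_nat scaler_eq0 pnatr_eq0 /=.
  rewrite mulf_eq0 polyX_eq0 orbF.
  by move/eqP => o0; rewrite -[LHS]hE2 o0 mul0r addr0.
have ee : e ^+ 2 = c *: g ^+ k.
  apply/eqP; rewrite -subr_eq0 -(@comp_poly_eq0 _ _ 'X^2) ?size_polyXn //.
  by rewrite rmorphB /= comp_polyZ !rmorphXn /= -he hsq subrr.
have c0 : 0 <= c by rewrite -(pmulr_lge0 _ (exprn_gt0 k g0)) -h0 sqr_ge0.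
apply/eqP; rewrite eq_le c0 andbT.
have := sqr_ge0 e.[y]; rewrite -horner_exp ee hornerZ horner_exp.
by rewrite nmulr_lge0 // exprn_odd_lt0.
Qed.
End OddPower.

Section Parity.
Variables (R : rcfType) (n : nat).
Implicit Types (F H : {mpoly R[n]}) (m : 'X_{1..n}) (i : 'I_n).

Definition flip i (v : 'I_n -> R) : 'I_n -> R := fun j => (-1) ^+ (j == i) * v j.

Definition parity_part i (b : bool) H : {mpoly R[n]} :=
  \sum_(m <- msupp H | odd (m i) == b) H@_m *: 'X_[m].

Lemma parity_partD H i : parity_part i true H + parity_part i false H = H.
Proof.
rewrite [RHS]mpolyE (bigID (fun m => odd (m i))) /=; congr (_ + _).
  by apply: eq_bigl => m; case: odd.
by apply: eq_bigl => m; case: odd.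
Qed.

Lemma msupp_parity_part i b H m :
  m \in msupp (parity_part i b H) -> m \in msupp H /\ odd (m i) = b.
Proof.
move=> mp; have : (parity_part i b H)@_m != 0 by rewrite mcoeff_eq0 mp.
rewrite /parity_part linear_sum /= big_seq_cond => /eqP mp0.
have [/andP[]|no] := boolP ((m \in msupp H) && (odd (m i) == b)); first by move=> ? /eqP.
case: mp0; apply: big1 => m' /andP[m'H m'b]; rewrite mcoeffZ mcoeffX.
case: eqP => [mm'|]; last by rewrite mulr0.
by move: no; rewrite -mm' m'H m'b.
Qed.

Lemma parity_part_flip i b H v :
  (parity_part i b H).@[flip i v] = (-1) ^+ b * (parity_part i b H).@[v].
Proof.
rewrite /parity_part !rmorph_sum big_distrr /=; apply: eq_bigr => m /eqP mb.
rewrite !mevalZ !mevalX mulrCA; congr (_ * _).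
rewrite (eq_bigr (fun j => ((-1) ^+ (j == i)) ^+ m j * v j ^+ m j)); last first.
  by move=> j _; rewrite exprMn.
rewrite big_split /=; congr (_ * _); rewrite (bigD1 i) //= eqxx big1 ?mulr1.
  by rewrite expr1 -signr_odd mb.
by move=> j /negPf ->; rewrite expr1n.
Qed.

(** The two parts take the values (H(v) + H(flip v)) / 2 and
    (H(v) - H(flip v)) / 2 up to sign, and squaring is convex. *)
Lemma parity_part_bounded (Q : ('I_n -> R) -> R) i b H :
    (forall v, Q (flip i v) = Q v) -> (forall v, H.@[v] ^+ 2 <= Q v) ->
  forall v, (parity_part i b H).@[v] ^+ 2 <= Q v.
Proof.
move=> Qi HQ v.
have h1 := HQ v; have h2 := HQ (flip i v).
move: h1 h2; rewrite Qi -{1 2}(parity_partD H i) !mevalD !parity_part_flip.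
rewrite expr1 expr0 mulN1r mul1r => h1 h2.
have := sqr_ge0 (parity_part i (~~ b) H).@[v].
case: b; move: h1 h2; rewrite /=; lra.
Qed.

(** Splitting along the variables one after the other and keeping a nonzero part
    each time. *)
Lemma parity_component (Q : ('I_n -> R) -> R) H d :
    (forall i v, Q (flip i v) = Q v) -> (forall v, H.@[v] ^+ 2 <= Q v) ->
    H != 0 -> H \is d.-homog ->
  exists H', [/\ H' != 0, H' \is d.-homog, forall v, H'.@[v] ^+ 2 <= Q v &
    forall i, exists b, forall m, m \in msupp H' -> odd (m i) = b].
Proof.
move=> Qi HQ H0 Hd.
suff [H' [H'0 H'd H'Q H'p]] : exists H', [/\ H' != 0, H' \is d.-homog,
    forall v, H'.@[v] ^+ 2 <= Q v &
    {in enum 'I_n, forall i, exists b, forall m, m \in msupp H' -> odd (m i) = b}].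
  by exists H'; split=> // i; apply: H'p; rewrite mem_enum.
elim: (enum 'I_n) => [|i s [G [G0 Gd GQ Gp]]]; first by exists H; split.
have [b Gb] : exists b, parity_part i b G != 0.
  have [G1|] := eqVneq (parity_part i true G) 0; last by exists true.
  exists false; apply: contraNneq G0 => G2.
  by rewrite -(parity_partD G i) G1 G2 addr0.
exists (parity_part i b G); split=> //.
- by apply/dhomogP => m /msupp_parity_part[mG _]; apply: (dhomogP _ _ _ Gd).
- exact: parity_part_bounded.
move=> j; rewrite inE => /predU1P[->|/Gp[b' Gb']].
  by exists b => m /msupp_parity_part[].
by exists b' => m /msupp_parity_part[/Gb'].
Qed.

Lemma even_descent K d : K \is (2 * d).-homog ->
    (forall m i, m \in msupp K -> ~~ odd (m i)) ->
  exists2 F, F \is d.-homog & K = mmap (@mpolyC n R) (fun i => 'X_i ^+ 2) F.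
Proof.
move=> Kd Keven; pose half m := [multinom (m i)./2 | i < n]%MM.
exists (\sum_(m <- msupp K) K@_m *: 'X_[half m]).
  rewrite big_seq; apply: rpred_sum => m mK; apply: rpredZ; rewrite dhomogX /=.
  have := dhomogP _ _ _ Kd m mK => /= md.
  rewrite -(eqn_pmul2l (isT : 0 < 2)%N) -md !mdegE big_distrr /=; apply/eqP.
  apply: eq_bigr => i _; rewrite mnmE mul2n.
  by rewrite -[RHS]odd_double_half (negPf (Keven _ _ mK)).
rewrite rmorph_sum /= [LHS]mpolyE big_seq [RHS]big_seq; apply: eq_bigr => m mK.
rewrite mmapZ mul_mpolyC mmapX /mmap1 mpolyXE_id; congr (_ *: _).
apply: eq_bigr => i _; rewrite mnmE -exprM mul2n.
by rewrite -[in LHS](odd_double_half (m i)) (negPf (Keven _ _ mK)).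
Qed.
End Parity.

Section Stubborn.
Variables (R : realType) (n : nat).
Implicit Types (f F H : {mpoly R[n]}).

Definition at_squares f : {mpoly R[n]} := mmap (@mpolyC n R) (fun i => 'X_i ^+ 2) f.

Lemma at_squares_homog f d : f \is d.-homog -> at_squares f \is (2 * d).-homog.
Proof.
move=> fd; rewrite /at_squares /mmap big_seq; apply: rpred_sum => m mf.
rewrite mul_mpolyC; apply: rpredZ; rewrite /mmap1.
under eq_bigr do rewrite exprAC; rewrite prodrXl -mpolyXE_id mulnC.
by apply: dhomogMn; rewrite dhomogX (dhomogP _ _ _ fd).
Qed.

Lemma mmap_at_squares (S : comNzRingType) (h : {rmorphism R -> S})
    (T : 'I_n -> S) f :
  mmap h T (at_squares f) = mmap h (fun i => T i ^+ 2) f.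
Proof.
rewrite [LHS](rmorph_mmap (mmap h T)); apply: eq_mmap => [c|i] /=; first by rewrite mmapC.
by rewrite rmorphXn /= mmapX mmap1U.
Qed.

Lemma at_squares_meval f v : (at_squares f).@[v] = f.@[fun i => v i ^+ 2].
Proof. exact: (mmap_at_squares idfun). Qed.

Lemma dominated_at_squares f F k :
  (forall v, (at_squares F).@[v] <= (at_squares f).@[v] ^+ k) ->
  (forall v, 0 <= (at_squares F).@[v]) -> dominated f k F.
Proof.
move=> Ff F0 v v0 _; pose w i := Num.sqrt (v i).
have sq p : p.@[v] = (at_squares p).@[w].
  by rewrite at_squares_meval; apply: meval_eq => i; rewrite sqr_sqrtr // ltW.
by rewrite ger0_norm sq ?sq.
Qed.

(** Along the curve l, at_squares f becomes g(x^2); the values g(0) > 0 and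
    g(y) < 0 with y < 0 exclude that an odd power is a multiple of a square. *)
Lemma stubborn_at_squares f d (l : 'I_n -> {poly R}) (g : {poly R}) y :
    f \is d.-homog -> nonnegative (at_squares f) ->
    (forall k F, F \is (d * k).-homog -> dominated f k F -> exists c, F = c *: f ^+ k) ->
    mmap polyC l (at_squares f) = g \Po 'X^2 ->
    0 < g.[0] -> y < 0 -> g.[y] < 0 ->
  stubborn (2 * d) (at_squares f).
Proof.
move=> fd P0 extr lP g0 y0 gy; set P := at_squares f in P0 lP *.
split=> // [|k ok [e [s [ke sd Ps]]]]; first exact: at_squares_homog.
have {ke} eE : e = (d * k)%N.
  by apply/eqP; rewrite -(eqn_pmul2l (isT : 0 < 2)%N) -ke mulnCA (mulnC k).
have s0 h : h \in s -> h = 0.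
  move=> hs; apply/eqP/negPn/negP => h0.
  have hP v : h.@[v] ^+ 2 <= P.@[v] ^+ k.
    rewrite -!(rmorphXn (meval v)) Ps (big_rem h hs) rmorphD /= lerDl raddf_sum.
    by apply: sumr_ge0 => h' _; rewrite /= rmorphXn sqr_ge0.
  have Pflip i v : P.@[flip i v] ^+ k = P.@[v] ^+ k.
    congr (_ ^+ k); rewrite !at_squares_meval; apply: meval_eq => j.
    by rewrite /flip exprMn sqrr_sign mul1r.
  have [H [H0 Hd HP Hp]] := parity_component Pflip hP h0 (sd _ hs).
  have [|m i|F Fd FH] := @even_descent _ _ (H ^+ 2) (d * k)%N.
  - by rewrite -eE mulnC; apply: dhomogMn.
  - have [b Hb] := Hp i; rewrite expr2 => /msuppM_le /allpairsP[[m1 m2] /= [m1H m2H ->]].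
    by rewrite mnmDE oddD (Hb _ m1H) (Hb _ m2H) addbb.
  rewrite -/(at_squares F) in FH.
  have [|c Fc] := extr k F Fd.
    by apply: dominated_at_squares => v; rewrite -FH rmorphXn /= ?sqr_ge0.
  have Hl : (mmap polyC l H) ^+ 2 = c *: (g \Po 'X^2) ^+ k.
    rewrite -lP -rmorphXn /= FH Fc -!rmorphXn /=.
    by rewrite /at_squares !mmapZ mul_mpolyC mmapZ mul_polyC !rmorphXn.
  have c0 := odd_power_not_square ok g0 y0 gy Hl.
  by move: H0; rewrite -sqrf_eq0 FH Fc c0 scale0r /at_squares rmorph0 eqxx.
have : P ^+ k = 0.
  by rewrite Ps big_seq big1 // => h /s0 ->; rewrite expr0n.
move/eqP; rewrite expf_eq0 => /andP[_ /eqP PZ].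
move: lP; rewrite PZ rmorph0 => /(congr1 (horner^~ 0)) /esym.
by rewrite horner_comp hornerXn expr0n horner0 => gz; move: g0; rewrite gz ltxx.
Qed.
End Stubborn.

(** * Nodal cubics *)

Local Notation i1 := (@Ordinal 3 0 isT).
Local Notation i2 := (@Ordinal 3 1 isT).
Local Notation i3 := (@Ordinal 3 2 isT).
Local Notation X1 := 'X_i1.
Local Notation X2 := 'X_i2.
Local Notation X3 := 'X_i3.

Lemma ord3P (P : 'I_3 -> Prop) :
  P i1 -> P i2 -> P i3 -> forall i, P i.
Proof. by move=> P0 P1 P2 [[|[|[|//]]] lt_i]; rewrite (bool_irrelevance lt_i isT). Qed.

Definition triple (A : Type) (a b c : A) : 'I_3 -> A := fun i => nth a [:: a; b; c] i.

Lemma mpoly_neq0 n (R : comNzRingType) (p : {mpoly R[n]}) v : p.@[v] != 0 -> p != 0.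
Proof. by apply: contraNneq => ->; rewrite meval0. Qed.

Lemma coprimep_bezout (R : fieldType) (p q a b : {poly R}) :
  a * p + b * q = 1 -> coprimep p q.
Proof. by move=> ab; apply/Bezout_coprimepP; exists (a, b); rewrite /= ab eqpxx. Qed.

Lemma coprimep_dvdXM (R : fieldType) (p q r : {poly R}) j :
  coprimep p q -> p ^+ j %| r -> q ^+ j %| r -> (p * q) ^+ j %| r.
Proof. by move=> pq pr qr; rewrite exprMn Gauss_dvdp ?pr ?coprimep_expl ?coprimep_expr. Qed.

Lemma size_mul3_leq (R : comNzRingType) (p q r : {poly R}) :
  (size p <= 2)%N -> (size q <= 2)%N -> (size r <= 2)%N -> (size (p * q * r)%R <= 4)%N.
Proof.
move=> p2 q2 r2; have pq3 : (size (p * q)%R <= 3)%N.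
  by rewrite (leq_trans (size_polyMleq _ _)) // -subn1 leq_subLR (leq_trans (leq_add p2 q2)).
by rewrite (leq_trans (size_polyMleq _ _)) // -subn1 leq_subLR (leq_trans (leq_add pq3 r2)).
Qed.

Section NodalCubic.
Variable R : realFieldType.

(** Form of [order_along_thickening] used below. The signs b and c are there
    because the thickening that stays in the orthant may reach the curve
    at t = - e, or reach the opposite of the point phi, which is the same
    point of the projective plane. *)
Lemma contact_order (n : nat) (f F : {mpoly R[n]}) (phi : 'I_n -> {poly R})
    (e : {poly R}) (w : nat) (b c : bool) (x y : R)
    (T : 'I_n -> {poly {poly R}}) (U0 : {poly R}) (U1 : {poly {poly R}}) k d :
    x < y ->
    (forall i, (T i).[(-1) ^+ b * e] = (-1) ^+ c * phi i) ->
    (forall z t, x < z < y -> 0 < t -> forall i, 0 < (T i).[t%:P].[z]) ->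
    (forall z t, f.@[fun i => (T i).[t%:P].[z]] = t ^+ w * (U0.[z] + t * U1.[t%:P].[z])) ->
    (forall z, x < z < y -> 0 < U0.[z]) ->
  F \is d.-homog -> dominated f k F -> (e ^+ w) ^+ k %| mmap polyC phi F.
Proof.
move=> xy Te T0 fT U00 Fd Fdom; rewrite -exprM.
have sgn_dvd (s : nat) (p q : {poly R}) : ((-1) ^+ s * p %| q) = (p %| q).
  by rewrite -signr_odd; case: odd; rewrite ?mulN1r ?mul1r ?dvdpNl.
have dvd_sgn (s : nat) (p q : {poly R}) : (p %| (-1) ^+ s * q) = (p %| q).
  by rewrite -signr_odd; case: odd; rewrite ?mulN1r ?mul1r ?dvdpNr.
pose U := U0%:P + 'X * U1.
have fTU z t : f.@[fun i => (T i).[t%:P].[z]] = t ^+ w * U.[t%:P].[z].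
  by rewrite fT /U !hornerE.
have UU0 z : x < z < y -> 0 < U.[0].[z].
  by move=> /U00; rewrite /U !hornerE.
have := order_along_thickening ((-1) ^+ b * e) xy Fdom T0 fTU UU0.
rewrite (eq_mmap (h2 := polyC) (T2 := fun i => (-1) ^+ c * phi i)) //.
by rewrite (mmap_scale _ _ _ Fd) exprMn -!exprM dvd_sgn sgn_dvd.
Qed.

(** The parametrization phi is taken over all rings at once: over {poly R} for
    counting zeros, over {mpoly R[3]} for dividing by f. The bound 9 is the
    product of the degrees of F and phi, divided by k. *)
Lemma nodal_cubic_extremal (f : {mpoly R[3]})
    (phi : forall A : comNzRingType, A -> A -> 'I_3 -> A)
    (u v D : {mpoly R[3]}) (B : {poly R}) k F :
    (forall (A A' : comNzRingType) (r : {rmorphism A -> A'}) u v i,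
      r (phi _ u v i) = phi _ (r u) (r v) i) ->
    (forall (A : comNzRingType) (c u v : A) i,
      phi _ (c * u) (c * v) i = c ^+ 3 * phi _ u v i) ->
    (forall i, (size (phi {poly R} 'X%R ('X + 1)%R i) <= 4)%N) ->
    f != 0 -> f \is 3.-homog -> u != v -> D != 0 ->
    (forall i, D * 'X_i = f + phi _ u v i) ->
    (forall r g, D * r = phi _ u v i1 * g -> exists s, g = D * s) ->
    (9 < (size B).-1)%N ->
    (forall j G, G \is (3 * j).-homog -> dominated f j G ->
      B ^+ j %| mmap polyC (phi _ 'X ('X + 1)) G) ->
  F \is (3 * k).-homog -> dominated f k F -> exists c, F = c *: f ^+ k.
Proof.
move=> phiM phiH phi4 f0 fd uv D0 DX cancel sB contact Fd Fdom.
apply: dominated_extremal f0 fd phi4 sB _ contact Fd Fdom.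
move=> G e Ge G0; apply: (dvd_of_parametrization D0 DX cancel Ge).
exact: mmap_homogenize uv Ge G0.
Qed.
End NodalCubic.

(** The linear forms u, v, w with u + v + w = 0 in the chart u = z, v = z + 1,
    and the quadratic form whose roots are the two parameters of the node. *)
Section Factors.
Variable R : realFieldType.
Definition lin_u : {poly R} := 'X.
Definition lin_v : {poly R} := 'X + 1.
Definition lin_w : {poly R} := - ('X + ('X + 1)).
Definition quad : {poly R} := lin_u ^+ 2 + lin_u * lin_v + lin_v ^+ 2.

Lemma size_lin_u : size lin_u = 2. Proof. exact: size_polyX. Qed.
Lemma size_lin_v : size lin_v = 2. Proof. exact: size_XaddC. Qed.
Lemma size_lin_w : size lin_w = 2.
Proof.
rewrite /lin_w size_polyN addrA -mulr2n -scaler_nat size_polyDl ?size_scale ?pnatr_eq0 ?size_polyX //.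
by rewrite size_poly1.
Qed.
Lemma size_quad : size quad = 3.
Proof.
have -> : quad = 3 *: 'X^2 + (3 *: 'X + 1) by rewrite /quad /lin_u /lin_v -!mul_polyC; ring.
have s1 : size (3 *: 'X + 1 : {poly R}) = 2.
  by rewrite size_polyDl ?size_scale ?pnatr_eq0 ?size_polyX ?size_poly1.
by rewrite size_polyDl ?size_scale ?pnatr_eq0 ?size_polyXn ?s1.
Qed.

Lemma coprime_factors :
  [/\ coprimep quad lin_u, coprimep quad lin_v, coprimep quad lin_w &
   [/\ coprimep lin_u lin_v, coprimep lin_u lin_w & coprimep lin_v lin_w]].
Proof.
(* In this chart v - u = 1, quad = 1 + 3 u v and 4 quad = 1 + 3 w^2. *)
split; last split.
- by apply: (@coprimep_bezout _ _ _ 1 (- (3 *: lin_v))); rewrite /quad /lin_u /lin_v -!mul_polyC; ring.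
- by apply: (@coprimep_bezout _ _ _ 1 (- (3 *: lin_u))); rewrite /quad /lin_u /lin_v -!mul_polyC; ring.
- by apply: (@coprimep_bezout _ _ _ 4 (- (3 *: lin_w))); rewrite /quad /lin_u /lin_v /lin_w -!mul_polyC; ring.
- by apply: (@coprimep_bezout _ _ _ (-1) 1); rewrite /lin_u /lin_v; ring.
- by apply: (@coprimep_bezout _ _ _ (-2) (-1)); rewrite /lin_u /lin_w; ring.
- by apply: (@coprimep_bezout _ _ _ 2 1); rewrite /lin_v /lin_w; ring.
Qed.

(** Positive degrees exclude the zero polynomial. *)
Lemma degree_mul (p q : {poly R}) a b :
  (size p).-1 = a.+1 -> (size q).-1 = b.+1 -> (size (p * q)%R).-1 = (a.+1 + b.+1)%N.
Proof.
have sz (r : {poly R}) c : (size r).-1 = c.+1 -> (r != 0) * (size r = c.+2).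
  by rewrite -size_poly_eq0; case: (size r) => [|s] //= ->.
by move=> /sz[p0 ps] /sz[q0 qs]; rewrite size_mul // ps qs addSn addnS.
Qed.
End Factors.

Definition horner_simp := (hornerD, hornerN, hornerM, hornerZ, horner_exp, hornerXn,
  hornerX, hornerC, expr1, expr0).
Definition meval_simp := (mevalD, mevalB, mevalN, mevalM, mevalXU, rmorphXn).
Definition rmorph_simp := (rmorphD, rmorphN, rmorphM, rmorphXn).
Ltac positivity := repeat first [assumption | apply: exprn_gt0 | apply: mulr_gt0 | apply: addr_gt0].

Lemma monomial3_homog n (R : comNzRingType) (i j k : 'I_n) :
  ('X_i * 'X_j * 'X_k : {mpoly R[n]}) \is 3.-homog.
Proof.
have Xh (l : 'I_n) : ('X_l : {mpoly R[n]}) \is 1.-homog by rewrite dhomogX /= mdeg1.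
exact: (dhomogM (dhomogM (Xh i) (Xh j)) (Xh k)).
Qed.

(** * The Motzkin form *)

Section Motzkin.
Variable R : realType.

Definition motzkin_cubic : {mpoly R[3]} :=
  X1 ^+ 2 * X2 + X1 * X2 ^+ 2 + X3 ^+ 3 - 3 * X1 * X2 * X3.

Definition motzkin_param (A : comNzRingType) (u v : A) : 'I_3 -> A :=
  triple (u * u * u) (v * v * v) (u * v * (- (u + v))).

Lemma mmap_motzkin_cubic (S : comNzRingType) (h : {rmorphism R -> S}) T :
  mmap h T motzkin_cubic =
    T i1 ^+ 2 * T i2
    + T i1 * T i2 ^+ 2
    + T i3 ^+ 3
    - 3 * T i1 * T i2 * T i3.
Proof.
by rewrite /motzkin_cubic !rmorph_simp /= !mmapX !mmap1U rmorph1; ring.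
Qed.

Lemma motzkin_cubic_homog : motzkin_cubic \is 3.-homog.
Proof.
rewrite [motzkin_cubic](_ : _ =
    X1 * X1 * X2 + X1 * X2 * X2 + X3 * X3 * X3 - (X1 * X2 * X3) *+ 3).
  by rewrite rpredB ?rpredD ?rpredMn ?monomial3_homog.
by rewrite /motzkin_cubic; ring.
Qed.

(** At the node the thickened point leaves (1, 1, 1), up to scaling, in a direction
    that depends on z; there f has order 2. At u = 0 (and likewise at v = 0)
    the curve passes through a coordinate vertex like (t^3, 1, t); there f has
    order 3. In each case the interval for z is one on which the thickened
    point has positive coordinates. *)
Lemma motzkin_contact k (F : {mpoly R[3]}) :
    F \is (3 * k).-homog -> dominated motzkin_cubic k F ->
  (quad R ^+ 2 * (lin_u R ^+ 3 * lin_v R ^+ 3)) ^+ k %| mmap polyC (motzkin_param 'X ('X + 1)) F.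
Proof.
move=> Fd Fdom.
have [DU DV DW [UV UW VW]] := coprime_factors R.
pose u := lin_u R; pose v := lin_v R; pose w := lin_w R.
apply: coprimep_dvdXM; first by rewrite coprimepMr !coprimep_expl ?coprimep_expr.
  apply: (@contact_order R 3 motzkin_cubic F _ (quad R) 2 true false 0 1
    (triple ((v ^+ 3)%:P + 'X) (v ^+ 3)%:P ((v ^+ 3)%:P + v%:P * 'X))
    (v ^+ 3 * (1 - 3 * v + 3 * v ^+ 2)) (v ^+ 3)%:P) Fd Fdom.
  - by [].
  - by elim/ord3P; rewrite /motzkin_param /triple /= !horner_simp /v /quad /lin_u /lin_v; ring.
  - move=> z t /andP[z0 z1] t0; have v0 : 0 < z + 1 by lra.
    by elim/ord3P; rewrite /triple /= /v /lin_v !horner_simp; positivity.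
  - by move=> z t; rewrite [LHS]mmap_motzkin_cubic /triple /= /v /lin_v !horner_simp; ring.
  - move=> z /andP[z0 z1]; have v0 : 0 < z + 1 by lra.
    by rewrite /v /lin_v !horner_simp; apply: mulr_gt0; [positivity|nra].
apply: coprimep_dvdXM; first by rewrite coprimep_expl ?coprimep_expr.
  apply: (@contact_order R 3 motzkin_cubic F _ (lin_u R) 3 false false (-1) (- (1/2))
    (triple 'X^3 (v ^+ 3)%:P ((v * w)%:P * 'X))
    (v ^+ 6 + (v * w) ^+ 3) (- (3 * v ^+ 4 * w)%:P + (v ^+ 3)%:P * 'X^2)) Fd Fdom.
  - by lra.
  - by elim/ord3P; rewrite /motzkin_param /triple /= !horner_simp /v /w /lin_u /lin_v /lin_w; ring.
  - move=> z t /andP[z0 z1] t0; have v0 : 0 < z + 1 by lra.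
    have w0 : 0 < - (z + (z + 1)) by lra.
    by elim/ord3P; rewrite /triple /= /v /w /lin_v /lin_w !horner_simp; positivity.
  - by move=> z t; rewrite [LHS]mmap_motzkin_cubic /triple /= /v /w /lin_v /lin_w !horner_simp; ring.
  - move=> z /andP[z0 z1]; have v0 : 0 < z + 1 by lra.
    have w0 : 0 < - (z + (z + 1)) by lra.
    by rewrite /v /w /lin_v /lin_w !horner_simp; positivity.
apply: (@contact_order R 3 motzkin_cubic F _ (lin_v R) 3 true true (- (1/2)) 0
  (triple ((- u) ^+ 3)%:P 'X^3 ((u * w)%:P * 'X))
  ((- u) ^+ 6 + (u * w) ^+ 3) ((3 * u ^+ 4 * w)%:P - (u ^+ 3)%:P * 'X^2)) Fd Fdom.
- by lra.
- by elim/ord3P; rewrite /motzkin_param /triple /= !horner_simp /u /w /lin_u /lin_v /lin_w; ring.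
- move=> z t /andP[z0 z1] t0; have u0 : 0 < - z by lra.
  have uw0 : 0 < z * - (z + (z + 1)) by nra.
  by elim/ord3P; rewrite /triple /= /u /w /lin_u /lin_w !horner_simp; positivity.
- by move=> z t; rewrite [LHS]mmap_motzkin_cubic /triple /= /u /w /lin_u /lin_w !horner_simp; ring.
- move=> z /andP[z0 z1]; have u0 : 0 < - z by lra.
  have uw0 : 0 < z * - (z + (z + 1)) by nra.
  by rewrite /u /w /lin_u /lin_w !horner_simp; positivity.
Qed.

(** Projection from the node: u, v, D are taken in the coordinates
    X1 - X3, X2 - X3 that vanish there. *)
Lemma motzkin_extremal k (F : {mpoly R[3]}) :
    F \is (3 * k).-homog -> dominated motzkin_cubic k F ->
  exists c, F = c *: motzkin_cubic ^+ k.
Proof.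
pose u : {mpoly R[3]} := X1 - X3; pose v : {mpoly R[3]} := X2 - X3.
pose D := u ^+ 2 + u * v + v ^+ 2.
apply: (@nodal_cubic_extremal _ _ motzkin_param u v D _ _ _ _ _ _ _ _ _ _ _ _ _ motzkin_contact).
- by move=> A A' r a b; elim/ord3P; rewrite /motzkin_param /triple /= !(rmorphM, rmorphN, rmorphD).
- by move=> A c a b; elim/ord3P; rewrite /motzkin_param /triple /=; ring.
- by elim/ord3P; apply: size_mul3_leq; rewrite ?size_lin_u ?size_lin_v ?size_lin_w.
- apply: (mpoly_neq0 (v := triple 0 0 1)).
  by rewrite [X in X != _]mmap_motzkin_cubic /triple /=; apply: lt0r_neq0; lra.
- exact: motzkin_cubic_homog.
- rewrite -subr_eq0; apply: (mpoly_neq0 (v := triple 1 0 0)).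
  by rewrite /u /v !meval_simp /triple /=; apply: lt0r_neq0; lra.
- apply: (mpoly_neq0 (v := triple 1 0 0)).
  by rewrite /D /u /v !meval_simp /triple /=; apply: lt0r_neq0; lra.
- by elim/ord3P; rewrite /motzkin_cubic /motzkin_param /triple /= /D /u /v; ring.
- move=> r g.
  have cancel g' r' : D * r' = u * g' -> exists s, g' = D * s.
    apply: (@cancel_linear _ _ u D (triple X3 X2 X3) (triple 1 0 0)).
    + rewrite /u; apply: (mpoly_neq0 (v := triple 1 0 0)).
      by rewrite !meval_simp /triple /=; apply: lt0r_neq0; lra.
    + by elim/ord3P; rewrite /triple /= /u; ring.
    + by rewrite /u rmorphB /= !mmapX !mmap1U /triple /= subrr.
    rewrite /D /u /v !rmorph_simp /= !mmapX !mmap1U /triple /=.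
    apply: (mpoly_neq0 (v := triple 0 1 0)).
    by rewrite !meval_simp /triple /=; apply: lt0r_neq0; lra.
  rewrite /motzkin_param /triple /= -!mulrA.
  move=> /cancel[s1 us1]; have /cancel[s2 us2] := esym us1; exact: cancel (esym us2).
rewrite (@degree_mul _ _ _ 3 5) // ?size_exp ?size_quad //.
by rewrite (@degree_mul _ _ _ 2 2) // size_exp ?size_lin_u ?size_lin_v.
Qed.

Lemma at_squares_motzkin : at_squares motzkin_cubic = motzkin R.
Proof. by rewrite /at_squares mmap_motzkin_cubic /motzkin; ring. Qed.

(** With s = |a b|, the value is
    (c^2 - s)^2 (c^2 + 2 s) + s^2 (|a| - |b|)^2. *)
Lemma motzkin_nonneg : nonnegative (motzkin R).
Proof.
move=> v; rewrite -at_squares_motzkin at_squares_meval [X in _ <= X]mmap_motzkin_cubic.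
set a := v _; set b := v _; set c := v _.
have : 0 <= (c ^+ 2 - `|a * b|) ^+ 2 * (c ^+ 2 + 2 * `|a * b|).
  by rewrite mulr_ge0 ?sqr_ge0 // addr_ge0 ?sqr_ge0 // mulr_ge0.
have : 0 <= `|a * b| ^+ 2 * (`|a| - `|b|) ^+ 2 by rewrite mulr_ge0 ?sqr_ge0.
have ea := real_normK (num_real a); have eb := real_normK (num_real b).
rewrite normrM; move: ea eb; set x := `|a|; set y := `|b| => ea eb.
by move=> h1 h2; rewrite -ea -eb; lra.
Qed.

Theorem motzkin_stubborn : stubborn 6 (motzkin R).
Proof.
rewrite -at_squares_motzkin.
(* At (1, 1, y) the cubic is (y - 1)^2 (y + 2). *)
apply: (@stubborn_at_squares _ _ _ 3 (triple 1 1 'X) ('X^3 - 3 *: 'X + 2%:P) (-3)).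
- exact: motzkin_cubic_homog.
- by rewrite at_squares_motzkin; exact: motzkin_nonneg.
- exact: motzkin_extremal.
- rewrite mmap_at_squares mmap_motzkin_cubic /triple /= -!mul_polyC.
  by rewrite !(rmorphB, rmorphD, rmorphM, rmorphXn) /= !comp_polyX !comp_polyC; ring.
- by rewrite !horner_simp; lra.
- by lra.
- by rewrite !horner_simp; lra.
Qed.
End Motzkin.

(** * The Choi-Lam form *)

Section ChoiLam.
Variable R : realType.

Definition choi_lam_cubic : {mpoly R[3]} :=
  X1 ^+ 2 * X2 + X2 ^+ 2 * X3 + X3 ^+ 2 * X1 - 3 * X1 * X2 * X3.

Definition choi_lam_param (A : comNzRingType) (u v : A) : 'I_3 -> A :=
  let w := - (u + v) in triple (u * u * w) (v * v * u) (w * w * v).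

Lemma mmap_choi_lam_cubic (S : comNzRingType) (h : {rmorphism R -> S}) T :
  mmap h T choi_lam_cubic =
    T i1 ^+ 2 * T i2
    + T i2 ^+ 2 * T i3
    + T i3 ^+ 2 * T i1
    - 3 * T i1 * T i2 * T i3.
Proof. by rewrite /choi_lam_cubic !rmorph_simp /= !mmapX !mmap1U rmorph1; ring. Qed.

Lemma choi_lam_cubic_homog : choi_lam_cubic \is 3.-homog.
Proof.
rewrite [choi_lam_cubic](_ : _ = X1 * X1 * X2 + X2 * X2 * X3 + X3 * X3 * X1 - (X1 * X2 * X3) *+ 3).
  by rewrite rpredB ?rpredD ?rpredMn ?monomial3_homog.
by rewrite /choi_lam_cubic; ring.
Qed.

(** Besides the node, the curve passes through the three coordinate vertices like
    (t^2, t, 1), up to a cyclic permutation; there f has order 2. *)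
Lemma choi_lam_contact k (F : {mpoly R[3]}) :
    F \is (3 * k).-homog -> dominated choi_lam_cubic k F ->
  (quad R ^+ 2 * (lin_u R ^+ 2 * (lin_v R ^+ 2 * lin_w R ^+ 2))) ^+ k
    %| mmap polyC (choi_lam_param 'X ('X + 1)) F.
Proof.
move=> Fd Fdom.
have [DU DV DW [UV UW VW]] := coprime_factors R.
pose u := lin_u R; pose v := lin_v R; pose w := lin_w R.
apply: coprimep_dvdXM; first by rewrite !coprimepMr !coprimep_expl ?coprimep_expr.
  apply: (@contact_order R 3 choi_lam_cubic F _ (quad R) 2 true true (- 1) 0
    (triple ((- u * v ^+ 2)%:P + (- u)%:P * 'X) (- u * v ^+ 2)%:P
       ((- u * v ^+ 2)%:P + v%:P * 'X))
    (- u * v ^+ 2 * (u ^+ 2 + u * v + v ^+ 2)) (- u * v ^+ 2)%:P) Fd Fdom.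
  - by lra.
  - by elim/ord3P; rewrite /choi_lam_param /triple /= !horner_simp /u /v /quad /lin_u /lin_v; ring.
  - move=> z t /andP[z0 z1] t0; have v0 : 0 < z + 1 by lra.
    have u0 : 0 < - z by lra.
    by elim/ord3P; rewrite /triple /= /u /v /lin_u /lin_v !horner_simp; positivity.
  - by move=> z t; rewrite [LHS]mmap_choi_lam_cubic /triple /= /u /v /lin_u /lin_v !horner_simp; ring.
  - move=> z /andP[z0 z1]; have v0 : 0 < z + 1 by lra.
    have u0 : 0 < - z by lra.
    by rewrite /u /v /lin_u /lin_v !horner_simp; apply: mulr_gt0; [positivity|nra].
apply: coprimep_dvdXM; first by rewrite !coprimepMr !coprimep_expl ?coprimep_expr.
  apply: (@contact_order R 3 choi_lam_cubic F _ (lin_u R) 2 false false (-1) (- (1/2))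
    (triple (w%:P * 'X^2) ((v ^+ 2)%:P * 'X) (w ^+ 2 * v)%:P)
    (v ^+ 5 * w ^+ 2 + v ^+ 2 * w ^+ 5)
    (- (3 * v ^+ 3 * w ^+ 3)%:P + (w ^+ 2 * v ^+ 2)%:P * 'X^2)) Fd Fdom.
  - by lra.
  - by elim/ord3P; rewrite /choi_lam_param /triple /= !horner_simp /v /w /lin_u /lin_v /lin_w; ring.
  - move=> z t /andP[z0 z1] t0; have v0 : 0 < z + 1 by lra.
    have w0 : 0 < - (z + (z + 1)) by lra.
    by elim/ord3P; rewrite /triple /= /v /w /lin_v /lin_w !horner_simp; positivity.
  - by move=> z t; rewrite [LHS]mmap_choi_lam_cubic /triple /= /v /w /lin_v /lin_w !horner_simp; ring.
  - move=> z /andP[z0 z1]; have v0 : 0 < z + 1 by lra.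
    have w0 : 0 < - (z + (z + 1)) by lra.
    by rewrite /v /w /lin_v /lin_w !horner_simp; positivity.
apply: coprimep_dvdXM; first by rewrite !coprimep_expl ?coprimep_expr.
  apply: (@contact_order R 3 choi_lam_cubic F _ (lin_v R) 2 true true (- (1/2)) 0
    (triple (u ^+ 2 * - w)%:P ((- u)%:P * 'X^2) ((w ^+ 2)%:P * 'X))
    ((u ^+ 2 * w) ^+ 2 * - u + w ^+ 4 * (u ^+ 2 * - w))
    ((- (3 * u ^+ 3 * w ^+ 3))%:P + (u ^+ 2 * w ^+ 2)%:P * 'X^2)) Fd Fdom.
  - by lra.
  - by elim/ord3P; rewrite /choi_lam_param /triple /= !horner_simp /u /w /lin_u /lin_v /lin_w; ring.
  - move=> z t /andP[z0 z1] t0; have u0 : 0 < - z by lra.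
    have w0 : 0 < - - (z + (z + 1)) by lra.
    have u2 : 0 < z ^+ 2 by rewrite -sqrrN exprn_gt0.
    have w2 : 0 < (- (z + (z + 1))) ^+ 2 by rewrite -sqrrN exprn_gt0.
    by elim/ord3P; rewrite /triple /= /u /w /lin_u /lin_w !horner_simp; positivity.
  - by move=> z t; rewrite [LHS]mmap_choi_lam_cubic /triple /= /u /w /lin_u /lin_w !horner_simp; ring.
  - move=> z /andP[z0 z1]; have u0 : 0 < - z by lra.
    have w0 : 0 < - - (z + (z + 1)) by lra.
    have u2 : 0 < z ^+ 2 by rewrite -sqrrN exprn_gt0.
    have w4 : 0 < (- (z + (z + 1))) ^+ 4 by rewrite exprn_even_gt0 //= -oppr_eq0 gt_eqF.
    have uw : 0 < (z ^+ 2 * - (z + (z + 1))) ^+ 2.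
      by rewrite -sqrrN -mulrN exprn_gt0 // mulr_gt0.
    by rewrite /u /w /lin_u /lin_w !horner_simp; positivity.
apply: (@contact_order R 3 choi_lam_cubic F _ (lin_w R) 2 false false 0 1
  (triple ((u ^+ 2)%:P * 'X) (v ^+ 2 * u)%:P (v%:P * 'X^2))
  (u ^+ 4 * (v ^+ 2 * u) + (v ^+ 2 * u) ^+ 2 * v)
  (- (3 * u ^+ 3 * v ^+ 3)%:P + (u ^+ 2 * v ^+ 2)%:P * 'X^2)) Fd Fdom.
- by lra.
- by elim/ord3P; rewrite /choi_lam_param /triple /= !horner_simp /u /v /lin_u /lin_v /lin_w; ring.
- move=> z t /andP[z0 z1] t0; have v0 : 0 < z + 1 by lra.
  by elim/ord3P; rewrite /triple /= /u /v /lin_u /lin_v !horner_simp; positivity.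
- by move=> z t; rewrite [LHS]mmap_choi_lam_cubic /triple /= /u /v /lin_u /lin_v !horner_simp; ring.
- move=> z /andP[z0 z1]; have v0 : 0 < z + 1 by lra.
  by rewrite /u /v /lin_u /lin_v !horner_simp; positivity.
Qed.

Lemma choi_lam_extremal k (F : {mpoly R[3]}) :
    F \is (3 * k).-homog -> dominated choi_lam_cubic k F ->
  exists c, F = c *: choi_lam_cubic ^+ k.
Proof.
pose u : {mpoly R[3]} := X2 - X1; pose v : {mpoly R[3]} := X3 - X2.
pose D := u ^+ 2 + u * v + v ^+ 2.
apply: (@nodal_cubic_extremal _ _ choi_lam_param u v D _ _ _ _ _ _ _ _ _ _ _ _ _ choi_lam_contact).
- by move=> A A' r a b; elim/ord3P; rewrite /choi_lam_param /triple /= !(rmorphM, rmorphN, rmorphD).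
- by move=> A c a b; elim/ord3P; rewrite /choi_lam_param /triple /=; ring.
- by elim/ord3P; apply: size_mul3_leq; rewrite ?size_lin_u ?size_lin_v ?size_lin_w.
- apply: (mpoly_neq0 (v := triple 1 1 0)).
  by rewrite [X in X != _]mmap_choi_lam_cubic /triple /=; apply: lt0r_neq0; lra.
- exact: choi_lam_cubic_homog.
- rewrite -subr_eq0; apply: (mpoly_neq0 (v := triple 0 1 1)).
  by rewrite /u /v !meval_simp /triple /=; apply: lt0r_neq0; lra.
- apply: (mpoly_neq0 (v := triple 1 0 0)).
  by rewrite /D /u /v !meval_simp /triple /=; apply: lt0r_neq0; lra.
- by elim/ord3P; rewrite /choi_lam_cubic /choi_lam_param /triple /= /D /u /v; ring.
- move=> r g.
  have cancel_u g' r' : D * r' = u * g' -> exists s, g' = D * s.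
    apply: (@cancel_linear _ _ u D (triple X1 X1 X3) (triple 0 1 0)).
    + rewrite /u; apply: (mpoly_neq0 (v := triple 0 1 0)).
      by rewrite !meval_simp /triple /=; apply: lt0r_neq0; lra.
    + by elim/ord3P; rewrite /triple /= /u; ring.
    + by rewrite /u rmorphB /= !mmapX !mmap1U /triple /= subrr.
    rewrite /D /u /v !rmorph_simp /= !mmapX !mmap1U /triple /=.
    apply: (mpoly_neq0 (v := triple 0 0 1)).
    by rewrite !meval_simp /triple /=; apply: lt0r_neq0; lra.
  have cancel_w g' r' : D * r' = - (u + v) * g' -> exists s, g' = D * s.
    apply: (@cancel_linear _ _ _ D (triple X3 X2 X3) (triple 1 0 0)).
    + rewrite /u /v; apply: (mpoly_neq0 (v := triple 1 0 0)).
      by rewrite !meval_simp /triple /=; apply: lt0r_neq0; lra.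
    + by elim/ord3P; rewrite /triple /= /u /v; ring.
    + by rewrite /u /v !rmorph_simp /= !mmapX !mmap1U /triple /=; ring.
    rewrite /D /u /v !rmorph_simp /= !mmapX !mmap1U /triple /=.
    apply: (mpoly_neq0 (v := triple 0 0 1)).
    by rewrite !meval_simp /triple /=; apply: lt0r_neq0; lra.
  rewrite /choi_lam_param /triple /= -!mulrA.
  move=> /cancel_u[s1 us1]; have /cancel_u[s2 us2] := esym us1; exact: cancel_w (esym us2).
rewrite (@degree_mul _ _ _ 3 5) // ?size_exp ?size_quad //.
rewrite (@degree_mul _ _ _ 1 3) // ?size_exp ?size_lin_u //.
by rewrite (@degree_mul _ _ _ 1 1) // size_exp ?size_lin_v ?size_lin_w.
Qed.

Lemma at_squares_choi_lam : at_squares choi_lam_cubic = choi_lam R.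
Proof. by rewrite /at_squares mmap_choi_lam_cubic /choi_lam; ring. Qed.

Lemma choi_lam_nonneg : nonnegative (choi_lam R).
Proof.
move=> p; rewrite -at_squares_choi_lam at_squares_meval [X in _ <= X]mmap_choi_lam_cubic.
set a := p _; set b := p _; set c := p _.
have -> : (a ^+ 2) ^+ 2 * b ^+ 2 + (b ^+ 2) ^+ 2 * c ^+ 2 + (c ^+ 2) ^+ 2 * a ^+ 2
    - 3 * a ^+ 2 * b ^+ 2 * c ^+ 2
  = (`|a| * (c ^+ 2 - `|a| * `|b|)) ^+ 2
    + c ^+ 2 * (`|b| * (`|b| - `|a|) ^+ 2 * (`|b| + 2 * `|a|)).
  rewrite -(real_normK (num_real a)) -(real_normK (num_real b)); ring.
rewrite addr_ge0 ?sqr_ge0 //; apply: mulr_ge0; first exact: sqr_ge0.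
apply: mulr_ge0; last by rewrite addr_ge0 // mulr_ge0.
by apply: mulr_ge0 => //; exact: sqr_ge0.
Qed.

Theorem choi_lam_stubborn : stubborn 6 (choi_lam R).
Proof.
rewrite -at_squares_choi_lam.
(* At (1, 1, y) the cubic is a square; at (1, 9, y) it is y^2 + 54 y + 9, with two
   negative roots and - 1 between them. *)
apply: (@stubborn_at_squares _ _ _ 3 (triple 1 3 'X) ('X^2 + 54 *: 'X + 9%:P) (-1)).
- exact: choi_lam_cubic_homog.
- by rewrite at_squares_choi_lam; exact: choi_lam_nonneg.
- exact: choi_lam_extremal.
- rewrite mmap_at_squares mmap_choi_lam_cubic /triple /= -!mul_polyC.
  by rewrite !(rmorphB, rmorphD, rmorphM, rmorphXn) /= !comp_polyX !comp_polyC; ring.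
- by rewrite !horner_simp; lra.
- by lra.
- by rewrite !horner_simp; lra.
Qed.
End ChoiLam.

(** * The Robinson form *)

Section Robinson.
Variable R : realType.

Definition robinson_cubic : {mpoly R[3]} :=
  X1 ^+ 3 + X2 ^+ 3 + X3 ^+ 3 + 3 * X1 * X2 * X3
  - (X1 ^+ 2 * X2 + X1 * X2 ^+ 2 + X1 ^+ 2 * X3 + X1 * X3 ^+ 2 + X2 ^+ 2 * X3 + X2 * X3 ^+ 2).

Definition robinson_param (A : comNzRingType) (u v : A) : 'I_3 -> A :=
  let w := - (u + v) in triple (u * u * (w - v)) (v * v * (u - w)) (w * w * (v - u)).

(** Schur's cubic a (a - b) (a - c) + b (b - a) (b - c) + c (c - a) (c - b). *)
Definition schur (A : comNzRingType) (a b c : A) : A :=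
  (a - b) ^+ 2 * (a + b - c) + c * (a - c) * (b - c).

Lemma mmap_robinson_cubic (S : comNzRingType) (h : {rmorphism R -> S}) T :
  mmap h T robinson_cubic =
    schur (T i1) (T i2) (T i3).
Proof. by rewrite /robinson_cubic /schur !rmorph_simp /= !mmapX !mmap1U rmorph1; ring. Qed.

Lemma robinson_cubic_homog : robinson_cubic \is 3.-homog.
Proof.
rewrite [robinson_cubic](_ : _ = X1 * X1 * X1 + X2 * X2 * X2 + X3 * X3 * X3 + (X1 * X2 * X3) *+ 3
  - (X1 * X1 * X2 + X1 * X2 * X2 + X1 * X1 * X3 + X1 * X3 * X3 + X2 * X2 * X3 + X2 * X3 * X3)).
  by rewrite rpredB ?rpredD ?rpredMn ?monomial3_homog.
by rewrite /robinson_cubic; ring.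
Qed.

(** Besides the node, the curve touches the three coordinate lines at
    (0, 1, 1), (1, 0, 1), (1, 1, 0). Near such a point f has order 2 when the
    difference of the two large coordinates has order 1 and the small one has
    order 2; U0 and U1 come from the expansion of f there and serve for the
    three points. *)
Lemma robinson_contact k (F : {mpoly R[3]}) :
    F \is (3 * k).-homog -> dominated robinson_cubic k F ->
  (quad R ^+ 2 * (lin_u R ^+ 2 * (lin_v R ^+ 2 * lin_w R ^+ 2))) ^+ k
    %| mmap polyC (robinson_param 'X ('X + 1)) F.
Proof.
move=> Fd Fdom.
have [DU DV DW [UV UW VW]] := coprime_factors R.
pose u := lin_u R; pose v := lin_v R; pose w := lin_w R; pose d := quad R.
have d0 (z : R) : 0 < z ^+ 2 + z * (z + 1) + (z + 1) ^+ 2.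
  by have := sqr_ge0 (z + 1 / 2); lra.
pose U0 (a g : {poly R}) := 2 * a * d ^+ 2 + g * a ^+ 2.
pose U1 (a g : {poly R}) : {poly {poly R}} := (d ^+ 3 + g * a * d)%:P
  - (g * d ^+ 2 + 2 * a * g ^+ 2)%:P * 'X - (g ^+ 2 * d)%:P * 'X^2 + (g ^+ 3)%:P * 'X^3.
apply: coprimep_dvdXM; first by rewrite !coprimepMr !coprimep_expl ?coprimep_expr.
  apply: (@contact_order R 3 robinson_cubic F _ (quad R) 2 true false (- 1) (- (1/2))
    (triple ((w ^+ 2 * (v - u))%:P + v%:P * 'X) ((w ^+ 2 * (v - u))%:P + (- u)%:P * 'X)
       (w ^+ 2 * (v - u))%:P)
    (w ^+ 2 * (v - u) * (u ^+ 2 + u * v + v ^+ 2)) ((v - u) * (v + u) ^+ 2)%:P) Fd Fdom.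
  - by lra.
  - by elim/ord3P; rewrite /robinson_param /triple /= !horner_simp
      /u /v /w /quad /lin_w /lin_u /lin_v; ring.
  - move=> z t /andP[z0 z1] t0; have v0 : 0 < z + 1 by lra.
    have u0 : 0 < - z by lra.
    have w0 : 0 < - (z + (z + 1)) by lra.
    have vu : 0 < z + 1 - z by lra.
    by elim/ord3P; rewrite /triple /= /u /v /w /lin_u /lin_v /lin_w !horner_simp; positivity.
  - by move=> z t; rewrite [LHS]mmap_robinson_cubic /schur /triple /=
      /u /v /w /lin_u /lin_v /lin_w !horner_simp; ring.
  - move=> z /andP[z0 z1].
    have w0 : 0 < - (z + (z + 1)) by lra.
    have vu : 0 < z + 1 - z by lra.
    have dz := d0 z.
    by rewrite /u /v /w /lin_u /lin_v /lin_w !horner_simp; apply: mulr_gt0; [positivity|].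
apply: coprimep_dvdXM; first by rewrite !coprimepMr !coprimep_expl ?coprimep_expr.
  apply: (@contact_order R 3 robinson_cubic F _ (lin_u R) 2 false true (-(2/3)) (- (1/3))
    (triple ((v - w)%:P * 'X^2) (v ^+ 2 * (w - u))%:P ((v ^+ 2 * (w - u))%:P + d%:P * 'X))
    (U0 (v ^+ 2 * (w - u)) (v - w)) (U1 (v ^+ 2 * (w - u)) (v - w))) Fd Fdom.
  - by lra.
  - by elim/ord3P; rewrite /robinson_param /triple /= !horner_simp
      /d /u /v /w /quad /lin_u /lin_v /lin_w; ring.
  - move=> z t /andP[z0 z1] t0; have v0 : 0 < z + 1 by lra.
    have vw : 0 < z + 1 - - (z + (z + 1)) by lra.
    have wu : 0 < - (z + (z + 1)) - z by lra.
    have dz := d0 z.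
    by elim/ord3P; rewrite /triple /=
      /d /quad /u /v /w /lin_u /lin_v /lin_w !horner_simp; positivity.
  - by move=> z t; rewrite [LHS]mmap_robinson_cubic /schur /U0 /U1 /triple /=
      /d /quad /u /v /w /lin_u /lin_v /lin_w !horner_simp; ring.
  - move=> z /andP[z0 z1]; have v0 : 0 < z + 1 by lra.
    have vw : 0 < z + 1 - - (z + (z + 1)) by lra.
    have wu : 0 < - (z + (z + 1)) - z by lra.
    have dz := d0 z; have two : 0 < (2 : R) by [].
    by rewrite /U0 /d /quad /u /v /w /lin_u /lin_v /lin_w !horner_simp; positivity.
apply: coprimep_dvdXM; first by rewrite !coprimep_expl ?coprimep_expr.
  apply: (@contact_order R 3 robinson_cubic F _ (lin_v R) 2 true false 0 1
    (triple ((w ^+ 2 * (v - u))%:P + d%:P * 'X) ((u - w)%:P * 'X^2) (w ^+ 2 * (v - u))%:P)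
    (U0 (w ^+ 2 * (v - u)) (u - w)) (U1 (w ^+ 2 * (v - u)) (u - w))) Fd Fdom.
  - by lra.
  - by elim/ord3P; rewrite /robinson_param /triple /= !horner_simp
      /d /u /v /w /quad /lin_u /lin_v /lin_w; ring.
  - move=> z t /andP[z0 z1] t0.
    have w2 : 0 < (- (z + (z + 1))) ^+ 2 by rewrite sqrrN exprn_gt0; lra.
    have vu : 0 < z + 1 - z by lra.
    have uw : 0 < z - - (z + (z + 1)) by lra.
    have dz := d0 z.
    by elim/ord3P; rewrite /triple /=
      /d /quad /u /v /w /lin_u /lin_v /lin_w !horner_simp; positivity.
  - by move=> z t; rewrite [LHS]mmap_robinson_cubic /schur /U0 /U1 /triple /=
      /d /quad /u /v /w /lin_u /lin_v /lin_w !horner_simp; ring.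
  - move=> z /andP[z0 z1].
    have w2 : 0 < (- (z + (z + 1))) ^+ 2 by rewrite sqrrN exprn_gt0; lra.
    have vu : 0 < z + 1 - z by lra.
    have uw : 0 < z - - (z + (z + 1)) by lra.
    have dz := d0 z; have two : 0 < (2 : R) by [].
    by rewrite /U0 /d /quad /u /v /w /lin_u /lin_v /lin_w !horner_simp; positivity.
apply: (@contact_order R 3 robinson_cubic F _ (lin_w R) 2 true false (-2) (-1)
  (triple (u ^+ 2 * (w - v))%:P ((u ^+ 2 * (w - v))%:P + d%:P * 'X) ((v - u)%:P * 'X^2))
  (U0 (u ^+ 2 * (w - v)) (v - u)) (U1 (u ^+ 2 * (w - v)) (v - u))) Fd Fdom.
- by lra.
- by elim/ord3P; rewrite /robinson_param /triple /= !horner_simp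
      /d /u /v /w /quad /lin_u /lin_v /lin_w; ring.
- move=> z t /andP[z0 z1] t0.
  have u2 : 0 < z ^+ 2 by rewrite -sqrrN exprn_gt0; lra.
  have vu : 0 < z + 1 - z by lra.
  have wv : 0 < - (z + (z + 1)) - (z + 1) by lra.
  have dz := d0 z.
  by elim/ord3P; rewrite /triple /=
      /d /quad /u /v /w /lin_u /lin_v /lin_w !horner_simp; positivity.
- by move=> z t; rewrite [LHS]mmap_robinson_cubic /schur /U0 /U1 /triple /=
      /d /quad /u /v /w /lin_u /lin_v /lin_w !horner_simp; ring.
- move=> z /andP[z0 z1].
  have u2 : 0 < z ^+ 2 by rewrite -sqrrN exprn_gt0; lra.
  have vu : 0 < z + 1 - z by lra.
  have wv : 0 < - (z + (z + 1)) - (z + 1) by lra.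
  have dz := d0 z; have two : 0 < (2 : R) by [].
  by rewrite /U0 /d /quad /u /v /w /lin_u /lin_v /lin_w !horner_simp; positivity.
Qed.

Lemma robinson_extremal k (F : {mpoly R[3]}) :
    F \is (3 * k).-homog -> dominated robinson_cubic k F ->
  exists c, F = c *: robinson_cubic ^+ k.
Proof.
pose u : {mpoly R[3]} := X2 - X3; pose v : {mpoly R[3]} := X3 - X1.
pose D := u ^+ 2 + u * v + v ^+ 2.
apply: (@nodal_cubic_extremal _ _ robinson_param u v D _ _ _ _ _ _ _ _ _ _ _ _ _ robinson_contact).
- by move=> A A' r a b; elim/ord3P; rewrite /robinson_param /triple /= !(rmorphM, rmorphN, rmorphD).
- by move=> A c a b; elim/ord3P; rewrite /robinson_param /triple /=; ring.
- have size_sub (p q : {poly R}) : size p = 2 -> size q = 2 -> (size (p - q)%R <= 2)%N.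
    by move=> p2 q2; rewrite (leq_trans (size_polyD _ _)) // size_polyN p2 q2.
  by elim/ord3P; apply: size_mul3_leq; rewrite ?size_sub ?size_lin_u ?size_lin_v ?size_lin_w.
- apply: (mpoly_neq0 (v := triple 1 0 0)).
  by rewrite [X in X != _]mmap_robinson_cubic /schur /triple /=; apply: lt0r_neq0; lra.
- exact: robinson_cubic_homog.
- rewrite -subr_eq0; apply: (mpoly_neq0 (v := triple 0 1 0)).
  by rewrite /u /v !meval_simp /triple /=; apply: lt0r_neq0; lra.
- apply: (mpoly_neq0 (v := triple 1 0 0)).
  by rewrite /D /u /v !meval_simp /triple /=; apply: lt0r_neq0; lra.
- by elim/ord3P; rewrite /robinson_cubic /robinson_param /triple /= /D /u /v; ring.
- move=> r g.
  have cancel_u g' r' : D * r' = u * g' -> exists s, g' = D * s.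
    apply: (@cancel_linear _ _ u D (triple X1 X3 X3) (triple 0 1 0)).
    + rewrite /u; apply: (mpoly_neq0 (v := triple 0 1 0)).
      by rewrite !meval_simp /triple /=; apply: lt0r_neq0; lra.
    + by elim/ord3P; rewrite /triple /= /u; ring.
    + by rewrite /u rmorphB /= !mmapX !mmap1U /triple /= subrr.
    rewrite /D /u /v !rmorph_simp /= !mmapX !mmap1U /triple /=.
    apply: (mpoly_neq0 (v := triple 0 0 1)).
    by rewrite !meval_simp /triple /=; apply: lt0r_neq0; lra.
  have cancel_wv g' r' : D * r' = (- (u + v) - v) * g' -> exists s, g' = D * s.
    apply: (@cancel_linear _ _ _ D (triple X1 (2 * X1 - X3) X3) (triple 0 (-1) 0)).
    + rewrite /u /v; apply: (mpoly_neq0 (v := triple 1 0 0)).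
      by rewrite !meval_simp /triple /=; apply: lt0r_neq0; lra.
    + by elim/ord3P; rewrite /triple /= /u /v; ring.
    + by rewrite /u /v !rmorph_simp /= !mmapX !mmap1U /triple /=; ring.
    rewrite /D /u /v !rmorph_simp /= !mmapX !mmap1U /triple /=.
    apply: (mpoly_neq0 (v := triple 0 0 1)).
    by rewrite !meval_simp /triple /=; apply: lt0r_neq0; lra.
  rewrite /robinson_param /triple /= -!mulrA.
  move=> /cancel_u[s1 us1]; have /cancel_u[s2 us2] := esym us1; exact: cancel_wv (esym us2).
rewrite (@degree_mul _ _ _ 3 5) // ?size_exp ?size_quad //.
rewrite (@degree_mul _ _ _ 1 3) // ?size_exp ?size_lin_u //.
by rewrite (@degree_mul _ _ _ 1 1) // size_exp ?size_lin_v ?size_lin_w.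
Qed.

Lemma at_squares_robinson : at_squares robinson_cubic = robinson R.
Proof. by rewrite /at_squares mmap_robinson_cubic /schur /robinson; ring. Qed.

(** The formula for schur has nonnegative terms once c is the smallest of the
    three. *)
Lemma schur_ge0 (a b c : R) : 0 <= a -> 0 <= b -> 0 <= c -> 0 <= schur a b c.
Proof.
have min3 (x y z : R) : 0 <= x -> 0 <= y -> 0 <= z -> z <= x -> z <= y -> 0 <= schur x y z.
  move=> x0 y0 z0 zx zy; apply: addr_ge0; last by rewrite !mulr_ge0 // subr_ge0.
  by apply: mulr_ge0; [exact: sqr_ge0 | lra].
have rot (x y z : R) : schur x y z = schur y z x by rewrite /schur; ring.
move=> a0 b0 c0; have [ab|/ltW ba] := lerP a b.
  have [ac|/ltW ca] := lerP a c; first by rewrite rot min3.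
  by rewrite min3 // (le_trans ca).
have [bc|/ltW cb] := lerP b c; first by rewrite 2!rot min3.
by rewrite min3 // (le_trans cb).
Qed.

Theorem robinson_stubborn : stubborn 6 (robinson R).
Proof.
rewrite -at_squares_robinson.
(* At (1, 0, y) the cubic is (y - 1)^2 (y + 1). *)
apply: (@stubborn_at_squares _ _ _ 3 (triple 1 0 'X) ('X^3 - 'X^2 - 'X + 1) (-2)).
- exact: robinson_cubic_homog.
- move=> v; rewrite at_squares_meval [X in _ <= X]mmap_robinson_cubic.
  by apply: schur_ge0; apply: sqr_ge0.
- exact: robinson_extremal.
- rewrite mmap_at_squares mmap_robinson_cubic /schur /triple /=.
  by rewrite !(rmorphB, rmorphD, rmorphXn) /= rmorph1 !comp_polyX; ring.
- by rewrite !horner_simp; lra.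
- by lra.
- by rewrite !horner_simp; lra.
Qed.
End Robinson.

Theorem corollary2 (R : realType) :
  stubborn 6 (motzkin R) /\ stubborn 6 (robinson R) /\ stubborn 6 (choi_lam R).
Proof.
split; first exact: motzkin_stubborn.
by split; [exact: robinson_stubborn | exact: choi_lam_stubborn].
Qed.
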